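(* Let $x_1\le\cdots\le x_n$ be fixed real numbers, let $p:\mathbb{R}\to[0,1]$ be any function (not necessarily isotonic), and let $Y_1,\dots,Y_n\in\{0,1\}$ be independent random variables with $\mathrm{pr}(Y_i=1)=p(x_i)$. Let $\alpha\in(0,1)$ and \[ \gamma(p):=\sup_{x\le y}\{p(x)-p(y)\}\ \ge 0 . \] Then \[ \mathrm{pr}\{L^{\alpha,\mathrm{raw}}(x)-\gamma(p)\le p(x)\le U^{\alpha,\mathrm{raw}}(x)+\gamma(p)\ \text{for all }x\in\mathbb{R}\}\ge 1-\alpha . \]
   Context: Set $x_0:=-\infty$, $x_{n+1}:=\infty$. $N$ is the number of distinct elements of $\{x_1,\dots,x_n\}$. $\mathcal{J}$ is the set of all index pairs $(j,k)$ with $1\le j\le k\le n$, $x_{j-1}<x_j$ and $x_k<x_{k+1}$. For $1\le j\le k\le n$, $n_{jk}=k-j+1$ and $Z_{jk}=\sum_{i=j}^kY_i$. For $x\in\mathbb{R}$, $U^{\alpha,\mathrm{raw}}(x)=\inf_{(j,k)\in\mathcal{J}:x_j\ge x}u^{\alpha/(N^2+N)}(Z_{jk},n_{jk})$ and $L^{\alpha,\mathrm{raw}}(x)=\sup_{(j,k)\in\mathcal{J}:x_k\le x}\ell^{\alpha/(N^2+N)}(Z_{jk},n_{jk})$, with infimum over the empty set equal to $1$ and supremum over the empty set equal to $0$. Clopper–Pearson bounds: for an integer $m\ge1$, $z\in\{0,\dots,m\}$ and $\delta\in(0,1)$, $u^\delta(z,m)=\max\{\xi\in[0,1]:\mathrm{pbin}(z,m,\xi)\ge\delta\}$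 and $\ell^\delta(z,m)=\min\{\xi\in[0,1]:\mathrm{pbin}(z-1,m,\xi)\le 1-\delta\}$, where $\mathrm{pbin}(\cdot,m,\xi)$ is the distribution function of the binomial distribution with parameters $m$ and $\xi$. *)

(* Defs.v *)
From HB Require Import structures.
From mathcomp Require Import all_boot all_order all_algebra.
From mathcomp Require Import all_classical all_reals all_analysis.

Set Implicit Arguments.
Unset Strict Implicit.
Unset Printing Implicit Defensive.

Import Order.TTheory GRing.Theory Num.Theory.
Import numFieldNormedType.Exports.

Local Open Scope classical_set_scope.
Local Open Scope ring_scope.

Definition mutually_independent d (T : measurableType d) (R : realType)
    (P : probability T R) d' (T' : measurableType d') (I : finType)
    (Y : I -> {RV P >-> T'}) : Prop :=
  forall (A : {set I}) (B : I -> set T'),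
    (forall i, measurable (B i)) ->
    P (\bigcap_(i in [set` A]) (Y i @^-1` B i)) =
      (\prod_(i in A) P (Y i @^-1` B i))%E.

Section clopper_pearson.
Context {R : realType}.
Implicit Types (z : int) (m : nat) (delta xi : R).

(* The first argument is an integer because [cp_lower] evaluates it at [z - 1],
   which is [-1] for [z = 0]. *)
Definition pbin z m xi : \bar R := binomial_prob m xi [set k : nat | k%:Z <= z].

(* The maximum and the minimum are rendered by [sup] and [inf]; they are
   attained, see [cp_upper_max] and [cp_lower_min]. *)
Definition cp_upper_set delta z m : set R :=
  [set xi | 0 <= xi <= 1 /\ (delta%:E <= pbin z m xi)%E].

Definition cp_lower_set delta z m : set R :=
  [set xi | 0 <= xi <= 1 /\ (pbin (z - 1) m xi <= (1 - delta)%:E)%E].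

Definition cp_upper delta (z m : nat) : R := sup (cp_upper_set delta z m).

Definition cp_lower delta (z m : nat) : R := inf (cp_lower_set delta z m).

End clopper_pearson.

Section attainment.
Context {R : realType}.

Let pbinr (z : int) m (xi : R) := \sum_(k < m.+1 | k%:Z <= z) binomial_pmf m xi k.

Let pbinE z m (xi : R) : 0 <= xi <= 1 -> pbin z m xi = (pbinr z m xi)%:E.
Proof.
move=> /andP[x0 x1].
rewrite /pbin (@binomial_probE _ m xi x0 x1) /pbinr [in RHS]big_mkcond/= -sumEFin.
apply: eq_bigr => k _; rewrite diracE.
have -> : ((k : nat) \in [set k : nat | k%:Z <= z]) = (k%:Z <= z).
  by apply/idP/idP => [/set_mem//|?]; exact/mem_set.
by case: ifP => _; rewrite ?mule1 ?mule0.
Qed.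

Let continuous_pbinr z m : continuous (pbinr z m).
Proof.
pose q : {poly R} := \sum_(k < m.+1 | k%:Z <= z)
  ('X ^+ k * (1 - 'X) ^+ (m - k) *+ 'C(m, k)).
have -> : pbinr z m = horner q.
  apply/funext => t; rewrite /pbinr /q horner_sum; apply: eq_bigr => k _.
  by rewrite /binomial_pmf hornerMn hornerM !horner_exp !hornerE.
exact: continuous_horner.
Qed.

Let compact_preimage z m (C : set R) : closed C ->
  compact ([set xi | 0 <= xi <= 1] `&` [set xi | C (pbinr z m xi)]).
Proof.
move=> Ccl; apply: (subclosed_compact _ (@segment_compact _ 0 1)); last first.
  by move=> t [] /=; rewrite in_itv.
apply: closedI.
  rewrite (_ : [set _ | _] = `[0, 1]%classic); first exact: itv_closed.
  by apply/seteqP; split => t /=; rewrite in_itv.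
by apply: closed_comp => // t _; exact: continuous_pbinr.
Qed.

Let sup_compact (A : set R) : A !=set0 -> compact A ->
  A (sup A) /\ ubound A (sup A).
Proof.
move=> A0 cA.
have idc : {within A, continuous (id : R -> R)}.
  by apply: continuous_subspaceT => t; exact: cvg_id.
have [c cinA cmax] := compact_EVT_max A0 cA idc.
have uc : ubound A c by move=> t At; apply: cmax; exact/mem_set.
have Ac := set_mem cinA.
suff -> : sup A = c by [].
by apply/le_anti/andP; split; [exact: ge_sup|apply: ub_le_sup => //; exists c].
Qed.

Let inf_compact (A : set R) : A !=set0 -> compact A ->
  A (inf A) /\ lbound A (inf A).
Proof.
move=> A0 cA.
have idc : {within A, continuous (id : R -> R)}.
  by apply: continuous_subspaceT => t; exact: cvg_id.
have [c cinA cmin] := compact_EVT_min A0 cA idc.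
have lc : lbound A c by move=> t At; apply: cmin; exact/mem_set.
have Ac := set_mem cinA.
suff -> : inf A = c by [].
by apply/le_anti/andP; split; [apply: ge_inf => //; exists c|exact: lb_le_inf].
Qed.

Lemma cp_upper_max (delta : R) (z m : nat) : delta <= 1 ->
  cp_upper_set delta z m (cp_upper delta z m) /\
  ubound (cp_upper_set delta z m) (cp_upper delta z m).
Proof.
move=> d1; rewrite /cp_upper.
have AE : cp_upper_set delta z m = [set xi | 0 <= xi <= 1] `&`
    [set xi | [set r | delta <= r] (pbinr z m xi)].
  by apply/seteqP; split => t /= [t01]; rewrite /cp_upper_set /cp_lower_set /= pbinE// lee_fin.
rewrite AE; apply: sup_compact; last exact/compact_preimage/closed_ge.
exists 0; split; rewrite /= ?lexx ?ler01// /pbinr.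
rewrite (bigD1 ord0)//= big1 => [|k /andP[_ k0]].
  by rewrite /binomial_pmf expr0 unstable.onem0 expr1n mul1r addr0 bin0.
by rewrite /binomial_pmf expr0n; move: k0; rewrite -val_eqE /= => /negPf->;
  rewrite !mul0r mul0rn.
Qed.

Lemma cp_lower_min (delta : R) (z m : nat) : delta <= 1 -> (z <= m)%N ->
  cp_lower_set delta z m (cp_lower delta z m) /\
  lbound (cp_lower_set delta z m) (cp_lower delta z m).
Proof.
move=> d1 zm; rewrite /cp_lower.
have AE : cp_lower_set delta z m = [set xi | 0 <= xi <= 1] `&`
    [set xi | [set r | r <= 1 - delta] (pbinr (z%:Z - 1) m xi)].
  by apply/seteqP; split => t /= [t01]; rewrite /cp_upper_set /cp_lower_set /= pbinE// lee_fin.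
rewrite AE; apply: inf_compact; last exact/compact_preimage/closed_le.
exists 1; split; rewrite /= ?lexx ?ler01// /pbinr.
rewrite big1 ?subr_ge0// => k.
rewrite lerBrDr lezD1 ltz_nat => kz.
rewrite /binomial_pmf unstable.onem1 expr0n subn_eq0 leqNgt (leq_trans kz zm)/=.
by rewrite mulr0 mul0rn.
Qed.

End attainment.

Section confidence_bands.
Context {R : realType} (n : nat) (x : 'I_n -> R).

(* Ordinals count from 0, so [i : 'I_n] stands for the index i + 1 of the
   sequence x_1, ..., x_n; [xext] is indexed from 0 to n + 1, with
   x_0 = -oo and x_(n+1) = +oo. *)
Definition xext (i : nat) : \bar R :=
  if i is k.+1 then (if insub k is Some j then (x j)%:E else +oo%E) else -oo%E.

Definition ndistinct : nat := size (undup (codom x)).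

Definition Jset : set ('I_n * 'I_n) :=
  [set jk : 'I_n * 'I_n |
           [/\ (jk.1 <= jk.2)%N,
                (xext jk.1 < xext jk.1.+1)%E &
                (xext jk.2.+1 < xext jk.2.+2)%E]].

Definition nobs (jk : 'I_n * 'I_n) : nat := (jk.2 - jk.1 + 1)%N.

Definition Zsum (y : 'I_n -> bool) (jk : 'I_n * 'I_n) : nat :=
  (\sum_(i < n | jk.1 <= i <= jk.2) y i)%N.

Definition level (alpha : R) : R := alpha / (ndistinct ^ 2 + ndistinct)%:R.

(* [inf set0] and [sup set0] are both 0 in the library. *)
Definition Uraw (alpha : R) (y : 'I_n -> bool) (t : R) : R :=
  let S := [set cp_upper (level alpha) (Zsum y jk) (nobs jk)
             | jk in Jset `&` [set jk | t <= x jk.1]] in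
  if S == set0 then 1 else inf S.

Definition Lraw (alpha : R) (y : 'I_n -> bool) (t : R) : R :=
  let S := [set cp_lower (level alpha) (Zsum y jk) (nobs jk)
             | jk in Jset `&` [set jk | x jk.2 <= t]] in
  if S == set0 then 0 else sup S.

End confidence_bands.

Definition isotonicity_defect {R : realType} (p : R -> R) : R :=
  sup [set p st.1 - p st.2 | st in [set st : R * R | st.1 <= st.2]].

(* Main.v *)
(** On the finitely many outcomes y of (Y_1, ..., Y_n), the generating function
    of the number of successes in a block A is the product over i in A of
    (1 - p_i) + p_i X, and its partial coefficient sums (the distribution
    function) decrease in every p_i. Comparing with the minimum or the maximum q of p
    over the block, i.e. with ((1 - q) + q X)^|A|, each of the two events
    "cp_upper < p_i for all i in A" and "cp_lower > p_i for all i in A" has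
    probability at most the level. There are at most (N^2 + N)/2 blocks, so with
    probability at least 1 - alpha none of these events occurs. Then every bound
    of a block is beaten by some p_i of that block, and p_i differs from p(x) in
    the wrong direction by at most the isotonicity defect. *)

Require Import Defs.
From HB Require Import structures.
From mathcomp Require Import all_boot all_order all_algebra.
From mathcomp Require Import all_classical all_reals all_analysis.
From mathcomp Require Import ring.

Import Order.TTheory GRing.Theory Num.Theory.
Import numFieldNormedType.Exports.

Set Implicit Arguments.
Unset Strict Implicit.

Local Open Scope classical_set_scope.
Local Open Scope ring_scope.

(** * Generating functions of sums of independent Bernoulli variables *)

Section generating_function.
Context {R : realDomainType}.
Implicit Types (a b : R) (G : {poly R}).

(** The probability generating function of a Bernoulli variable with parameter [a]. *)
Definition bern_poly a : {poly R} := (1 - a)%:P + a *: 'X.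

(** For a probability generating function, the probability of a value strictly below [z]; the strict
    bound lets [z = 0] match [pbin (-1)]. *)
Definition cumcoef G z : R := \sum_(k < z) G`_k.

Lemma coef_bern_polyM a G k :
  (bern_poly a * G)`_k = (1 - a) * G`_k + a * (if k is k'.+1 then G`_k' else 0).
Proof.
by rewrite /bern_poly mulrDl coefD coefCM -scalerAl coefZ coefXM; case: k.
Qed.

Lemma cumcoefS G z : cumcoef G z.+1 = cumcoef G z + G`_z.
Proof. by rewrite /cumcoef big_ord_recr. Qed.

Lemma cumcoef_bern_polyM a G z :
  cumcoef (bern_poly a * G) z.+1 = (1 - a) * cumcoef G z.+1 + a * cumcoef G z.
Proof.
elim: z => [|z IH].
  by rewrite /cumcoef !big_ord_recr !big_ord0/= !add0r coef_bern_polyM.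
rewrite cumcoefS IH coef_bern_polyM (cumcoefS _ z.+1) (cumcoefS _ z); ring.
Qed.

(** Factors are replaced one at a time. Raising a parameter from [a i] to [b i] lowers a partial sum
    by [b i - a i] times a coefficient of [G], so the induction also carries nonnegativity of the
    coefficients. *)
Lemma cumcoef_bern_prod_le (I : Type) (r : seq I) (A : pred I) (a b : I -> R) z :
  (forall i, A i -> 0 <= a i /\ a i <= b i /\ b i <= 1) ->
  cumcoef (\prod_(i <- r | A i) bern_poly (b i)) z <=
  cumcoef (\prod_(i <- r | A i) bern_poly (a i)) z.
Proof.
move=> ab; pose K G' G := (forall k, 0 <= G`_k) /\
  forall z, cumcoef G' z <= cumcoef G z.
suff [] : K (\prod_(i <- r | A i) bern_poly (b i))
            (\prod_(i <- r | A i) bern_poly (a i)) by move=> _; apply.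
apply: (big_rec2 K) => [|i G' G Ai [G0 GG']].
  by split => // k; rewrite coef1; case: eqP.
have [a0 [ab_i b1]] := ab i Ai.
have a1 : 0 <= 1 - a i by rewrite subr_ge0 (le_trans ab_i).
split=> [k|[|m]]; last 2 first.
- by rewrite /cumcoef !big_ord0.
- rewrite !cumcoef_bern_polyM; apply: (@le_trans _ _
    ((1 - b i) * cumcoef G m.+1 + b i * cumcoef G m)).
    by rewrite lerD// ler_wpM2l ?GG' ?subr_ge0// (le_trans a0).
  rewrite -subr_ge0 cumcoefS.
  rewrite [leRHS](_ : _ = (b i - a i) * G`_m); last by ring.
  by rewrite mulr_ge0 ?subr_ge0.
- rewrite coef_bern_polyM addr_ge0 ?mulr_ge0//.
  by case: k.
Qed.

Lemma coef_bern_polyX a m k :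
  (bern_poly a ^+ m)`_k = (a ^+ k * (1 - a) ^+ (m - k)) *+ 'C(m, k).
Proof.
rewrite /bern_poly exprDn coef_sum.
transitivity (\sum_(i < m.+1 | (i : nat) == k) (a ^+ k * (1 - a) ^+ (m - k)) *+ 'C(m, k)).
  rewrite [RHS]big_mkcond; apply: eq_bigr => i _.
  rewrite coefMn -rmorphXn coefCM exprZn coefZ coefXn eq_sym.
  case: eqP => [<-|_]; last by rewrite !mulr0 mul0rn.
  by rewrite mulr1 mulrC.
have [km|mk] := ltnP k m.+1.
  by rewrite (big_pred1 (Ordinal km)).
by rewrite big1 // => *; rewrite bin_small.
Qed.

End generating_function.

Lemma pbinE {R : realType} (z m : nat) (xi : R) : 0 <= xi <= 1 ->
  pbin (z%:Z - 1) m xi = (cumcoef (bern_poly xi ^+ m) z)%:E.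
Proof.
move=> /andP[x0 x1].
rewrite /pbin (@binomial_probE _ m xi x0 x1).
rewrite (eq_bigr (fun k : 'I_m.+1 =>
  (if (k < z)%N then (bern_poly xi ^+ m)`_k else 0)%:E)); last first.
  move=> k _; rewrite diracE.
  have -> : ((k : nat) \in [set k : nat | k%:Z <= z%:Z - 1]) = (k < z)%N.
    by rewrite -ltz_nat -lezD1 -lerBrDr; apply/idP/idP => [/set_mem//|?]; exact/mem_set.
  rewrite coef_bern_polyX.
  by case: ifP => _; rewrite ?mule1 ?mule0.
rewrite sumEFin /cumcoef; congr (_%:E).
rewrite -big_mkcond.
rewrite -(big_mkord (fun k => (k < z)%N) (fun k => (bern_poly xi ^+ m)`_k)).
rewrite -(big_mkord xpredT (fun k => (bern_poly xi ^+ m)`_k)).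
(* Both ranges are widened to a common one; beyond degree [m] the coefficients vanish because
   ['C(m, k)] does. *)
rewrite (big_nat_widen _ _ (m.+1 + z)) ?leq_addr//.
rewrite [RHS](big_nat_widen _ _ (m.+1 + z)) ?leq_addl//.
rewrite big_mkcond [RHS]big_mkcond; apply: eq_bigr => k _ /=.
have [|mk] := ltnP k m.+1; first by rewrite andbT.
by rewrite andbF coef_bern_polyX bin_small// mulr0n; case: ifP.
Qed.

(** * The product law on outcomes and the tails of its success counts *)

Definition successes {I : finType} (A : pred I) (y : {ffun I -> bool}) : nat :=
  (\sum_(i | A i) y i)%N.

Section product_law.
Context {R : realDomainType} {I : finType} (p : I -> R).
Implicit Types (A : pred I) (y : {ffun I -> bool}) (q delta : R).

Definition bern_weight y : R := \prod_i (if y i then p i else 1 - p i).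

(** Distributivity turns the product of sums into a sum over outcomes; an index outside [A] carries
    exponent 0 and contributes the factor 1. *)
Lemma bern_weight_genfun A :
  \sum_y bern_weight y *: 'X^(successes A y) =
  \prod_(i | A i) bern_poly (p i).
Proof.
rewrite [RHS]big_mkcond/=.
rewrite (eq_bigr (fun i => \sum_(b : bool)
    (if b then p i else 1 - p i) *: 'X^(if A i then nat_of_bool b else 0%N))); last first.
  move=> i _; rewrite big_bool /bern_poly; case: (A i) => /=.
    by rewrite expr1 expr0 addrC alg_polyC.
  by rewrite expr0 -scalerDl addrC subrK scale1r.
rewrite bigA_distr_bigA; apply: eq_bigr => y _.
by rewrite scaler_prod -expr_sum -big_mkcond.
Qed.

Lemma sum_bern_weight_lt A z :
  \sum_(y | (successes A y < z)%N) bern_weight y =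
  cumcoef (\prod_(i | A i) bern_poly (p i)) z.
Proof.
rewrite -bern_weight_genfun /cumcoef.
under [RHS]eq_bigr do rewrite coef_sum.
rewrite exchange_big big_mkcond; apply: eq_bigr => y _ /=.
under eq_bigr do rewrite coefZ coefXn.
set s := successes A y; case: ltnP => [sz|zs].
  rewrite (bigD1 (Ordinal sz))//= eqxx mulr1 big1 ?addr0// => k.
  by rewrite -val_eqE /= => /negPf ->; rewrite mulr0.
rewrite big1 // => k _; rewrite ltn_eqF ?mulr0//.
exact: leq_trans (ltn_ord k) zs.
Qed.

Lemma sum_bern_weight : \sum_y bern_weight y = 1.
Proof.
rewrite -(bigA_distr_bigA (fun i (b : bool) => if b then p i else 1 - p i)).
by rewrite big1 // => i _; rewrite big_bool/= addrC subrK.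
Qed.

Hypothesis p01 : forall i, 0 <= p i <= 1.

Lemma bern_weight_ge0 y : 0 <= bern_weight y.
Proof.
apply: prodr_ge0 => i _; have /andP[p0 p1] := p01 i.
by case: ifP; rewrite ?subr_ge0.
Qed.

Lemma sum_bern_weight_subset (Q Q' : pred {ffun I -> bool}) :
  {subset Q <= Q'} -> \sum_(y | Q y) bern_weight y <= \sum_(y | Q' y) bern_weight y.
Proof.
move=> QQ'; rewrite big_mkcond [leRHS]big_mkcond; apply: ler_sum => y _.
case: ifP => [/QQ'|_]; first by rewrite unfold_in => ->.
by case: ifP => // _; exact: bern_weight_ge0.
Qed.

(* The outcomes on the left form a lower tail of the law of the sum: bound the
   sum by its largest value among them. *)
Lemma binomial_lower_tail A q delta : 0 <= delta -> 0 <= q ->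
  (forall i, A i -> q <= p i) ->
  \sum_(y | cumcoef (bern_poly q ^+ #|A|) (successes A y).+1 < delta)
    bern_weight y <= delta.
Proof.
move=> d0 q0 qp; set S := successes A.
pose bad y := cumcoef (bern_poly q ^+ #|A|) (S y).+1 < delta.
have [/existsP[y0 bad0]|/existsPn nobad] := boolP [exists y, bad y]; last first.
  by rewrite big1 // => y By; move: (nobad y); rewrite /bad By.
case: (@arg_maxnP _ y0 bad S bad0) => ys bads maxs.
apply: le_trans (ltW bads).
apply: (@le_trans _ _ (\sum_(y | (S y < (S ys).+1)%N) bern_weight y)).
  by apply: sum_bern_weight_subset => y By; rewrite unfold_in ltnS; exact: maxs.
rewrite sum_bern_weight_lt -prodr_const.
apply: cumcoef_bern_prod_le => i Ai.
by have /andP[_ ?] := p01 i; split => //; split => //; exact: qp.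
Qed.

(** The outcomes on the left now lie in an upper tail, cut at their smallest sum. *)
Lemma binomial_upper_tail A q delta : 0 <= delta -> q <= 1 ->
  (forall i, A i -> p i <= q) ->
  \sum_(y | 1 - delta < cumcoef (bern_poly q ^+ #|A|) (successes A y))
    bern_weight y <= delta.
Proof.
move=> d0 q1 pq; set S := successes A.
pose bad y := 1 - delta < cumcoef (bern_poly q ^+ #|A|) (S y).
have [/existsP[y0 bad0]|/existsPn nobad] := boolP [exists y, bad y]; last first.
  by rewrite big1 // => y By; move: (nobad y); rewrite /bad By.
case: (@arg_minnP _ y0 bad S bad0) => ys bads mins.
apply: (@le_trans _ _ (\sum_(y | ~~ (S y < S ys)%N) bern_weight y)).
  by apply: sum_bern_weight_subset => y By; rewrite unfold_in -leqNgt; exact: mins.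
(* As the total weight is 1, it suffices that the outcomes below the cut weigh at least
   [1 - delta]. *)
have := sum_bern_weight; rewrite (bigID (fun y => (S y < S ys)%N))/= => tot.
rewrite -(lerD2l (\sum_(y | (S y < S ys)%N) bern_weight y)) tot -lerBlDr.
apply: (le_trans (ltW bads)); rewrite sum_bern_weight_lt -prodr_const.
apply: cumcoef_bern_prod_le => i Ai.
by have /andP[? _] := p01 i; split => //; split => //; exact: pq.
Qed.

End product_law.

(** * Miscoverage of one Clopper-Pearson bound *)

Section clopper_pearson_miscoverage.
Context {R : realType} {I : finType} (p : I -> R).
Hypothesis p01 : forall i, 0 <= p i <= 1.
Implicit Types (A : pred I) (y : {ffun I -> bool}) (q delta : R).

(** Otherwise [q] would belong to [cp_upper_set] and so be at most its supremum. *)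
Lemma cp_upper_lt delta z m q : 0 <= q <= 1 -> cp_upper delta z m < q ->
  cumcoef (bern_poly q ^+ m) z.+1 < delta.
Proof.
move=> q01; apply: contraTT; rewrite -!leNgt => dq.
apply: ub_le_sup; first by exists 1 => t [/andP[]].
split => //; have -> : z%:Z = z.+1%:Z - 1 by rewrite -addn1 PoszD addrK.
by rewrite pbinE // lee_fin.
Qed.

Lemma lt_cp_lower delta z m q : 0 <= q <= 1 -> q < cp_lower delta z m ->
  1 - delta < cumcoef (bern_poly q ^+ m) z.
Proof.
move=> q01; apply: contraTT; rewrite -!leNgt => dq.
apply: ge_inf; first by exists 0 => t [/andP[]].
by split => //; rewrite pbinE // lee_fin.
Qed.

Lemma cp_upper_miscoverage A delta : 0 <= delta -> (exists i, A i) ->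
  \sum_(y : {ffun I -> bool} | [forall (i | A i),
      cp_upper delta (successes A y) #|A| < p i]) bern_weight p y <= delta.
Proof.
move=> d0 [i0 Ai0].
(* The smallest [p i] over [A] is the comparison parameter: the others dominate it, and the bound
   fails at this index in particular. *)
have [i Ai imin] := arg_minP p Ai0.
have /andP[p0 p1] := p01 i.
apply: (le_trans _ (binomial_lower_tail p01 d0 p0 imin)).
apply: sum_bern_weight_subset => // y /forall_inP/(_ i Ai).
exact: cp_upper_lt.
Qed.

Lemma cp_lower_miscoverage A delta : 0 <= delta -> (exists i, A i) ->
  \sum_(y : {ffun I -> bool} | [forall (i | A i),
      p i < cp_lower delta (successes A y) #|A|]) bern_weight p y <= delta.
Proof.
move=> d0 [i0 Ai0].
(* For lower bounds the largest [p i] plays this role. *)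
have [i Ai imax] := arg_maxP p Ai0.
have /andP[p0 p1] := p01 i.
apply: (le_trans _ (binomial_upper_tail p01 d0 p1 imax)).
apply: sum_bern_weight_subset => // y /forall_inP/(_ i Ai).
exact: lt_cp_lower.
Qed.

End clopper_pearson_miscoverage.

(** * From the probability space to finitely many outcomes *)

Lemma probability_bern_weight {d} {T : measurableType d} {R : realType}
    (P : probability T R) (I : finType) (p : I -> R) (Y : I -> {RV P >-> bool})
    (Q : pred {ffun I -> bool}) :
  mutually_independent Y ->
  (forall i, P (Y i @^-1` [set true]) = (p i)%:E) ->
  P [set w | Q [ffun i => Y i w]] = (\sum_(y | Q y) bern_weight p y)%:E.
Proof.
move=> Yind Yp.
(* The cylinders [F y] partition the space; independence over the full index set gives each of them
   the weight of [y]. *)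
pose F (y : {ffun I -> bool}) := \bigcap_(i in [set` [set: I]%SET]) (Y i @^-1` [set y i]).
have mY i b : measurable (Y i @^-1` [set b]) by exact: measurable_funPTI.
have FE y w : F y w <-> [ffun i => Y i w] = y.
  split=> [Fy|<- i _]; last by rewrite /= ffunE.
  by apply/ffunP => i; rewrite ffunE; apply: Fy; rewrite /= inE.
have PF y : P (F y) = (bern_weight p y)%:E.
  rewrite /F (Yind _ (fun i => [set y i])) //.
  rewrite /bern_weight -prodEFin; apply: eq_big => [i|i _]; first by rewrite inE.
  case: (y i) => //.
  have -> : Y i @^-1` [set false] = ~` (Y i @^-1` [set true]).
    by apply/seteqP; split => w /=; case: (Y i w).
  by rewrite probability_setC // Yp.
rewrite (_ : [set w | _] = \bigcup_(y in [set` Q]) F y); last first.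
  apply/seteqP; split => [w Qw|w [y Qy /FE wy]]; last by rewrite /= wy.
  by exists [ffun i => Y i w] => //; exact/FE.
rewrite measure_fin_bigcup//; last first.
- by move=> y _; apply: fin_bigcap_measurable => // i _; exact: mY.
- by move=> y y' _ _ [w [/FE wy /FE wy']]; rewrite -wy.
rewrite -sumEFin -(bigfs _ (r := enum {ffun I -> bool})) ?enum_uniq//; last first.
  by move=> y _; rewrite mem_enum.
by rewrite big_enum_cond; apply: eq_bigr => y _; exact: PF.
Qed.

(** * Counting the blocks *)

Section index_pairs.
Context {R : realType} {n : nat} {x : 'I_n -> R}.
Hypothesis x_le : forall i j : 'I_n, (i <= j)%N -> x i <= x j.

Lemma xextS (i : 'I_n) : xext x i.+1 = (x i)%:E.
Proof. by rewrite /xext valK. Qed.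

(** If [j < j'] shared a value, monotonicity would give the predecessor of [j'] that value too,
    against the strict jump at [j']. *)
Lemma block_start_inj (j j' : 'I_n) :
  (xext x j < xext x j.+1)%E -> (xext x j' < xext x j'.+1)%E -> x j = x j' -> j = j'.
Proof.
wlog jj' : j j' / (j <= j')%N.
  move=> wl; have [|/ltnW] := leqP j j'; first exact: wl.
  by move=> jj' ? ? e; apply/esym/wl => //; rewrite e.
move=> _; rewrite xextS; move: jj'; rewrite leq_eqVlt => /orP[/eqP/val_inj//|].
case: j' => -[//|k] kn jk.
rewrite -[val (Ordinal kn)]/(Ordinal (ltnW kn)).+1 xextS.
rewrite lte_fin => + xjj'; rewrite -xjj' ltNge x_le//.
Qed.

(** The same argument, with the successor of the smaller index. *)
Lemma block_end_inj (k k' : 'I_n) :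
  (xext x k.+1 < xext x k.+2)%E -> (xext x k'.+1 < xext x k'.+2)%E ->
  x k = x k' -> k = k'.
Proof.
wlog kk' : k k' / (k <= k')%N.
  move=> wl; have [|/ltnW] := leqP k k'; first exact: wl.
  by move=> kk' ? ? e; apply/esym/wl => //; rewrite e.
move=> + _; rewrite xextS; move: kk'; rewrite leq_eqVlt => /orP[/eqP/val_inj//|kk'].
have kn : (k.+1 < n)%N by rewrite (leq_trans _ (ltn_ord k')).
rewrite -[k.+2]/((Ordinal kn).+1) xextS lte_fin => + xkk'.
by rewrite xkk' ltNge x_le.
Qed.

(* A pair of [Jset] is determined by the values (x_j, x_k), which form a weakly
   increasing pair of distinct values; there are N(N+1)/2 such pairs. *)
Lemma card_Jset :
  (#|[pred jk | `[< Jset x jk >]]| * 2 <= ndistinct x ^ 2 + ndistinct x)%N.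
Proof.
set V := seq_sub (undup (codom x)).
have cV : #|{: V}| = ndistinct x by rewrite card_seq_sub ?undup_uniq.
have xV i : x i \in undup (codom x) by rewrite mem_undup codom_f.
pose f (jk : 'I_n * 'I_n) : V * V := (SeqSub (xV jk.1), SeqSub (xV jk.2)).
(* Swapping coordinates shows that [le2] and [ge2] have equal size; they cover all N^2 pairs and
   meet in the N diagonal ones, so twice the size of [le2] is N^2 + N. *)
pose le2 := [set uv : V * V | val uv.1 <= val uv.2]%SET.
pose ge2 := [set uv : V * V | val uv.2 <= val uv.1]%SET.
have cge : #|ge2| = #|le2|.
  rewrite -(card_imset ge2 (f := fun uv : V * V => (uv.2, uv.1))); last first.
    by move=> [? ?] [? ?] [-> ->].
  apply: eq_card => -[u v]; rewrite inE; apply/imsetP/idP => [[[u' v']]|uv].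
    by rewrite inE /= => ? [-> ->].
  by exists (v, u); rewrite ?inE.
have cU : #|le2 :|: ge2|%SET = (ndistinct x ^ 2)%N.
  rewrite -cV -mulnn -card_prod -cardsT; apply: eq_card => uv.
  by rewrite !inE le_total.
have cI : #|le2 :&: ge2|%SET = ndistinct x.
  rewrite -cV -(card_imset {: V} (f := fun u : V => (u, u))); last by move=> ? ? [].
  apply: eq_card => -[u v]; rewrite !inE /=; apply/idP/imsetP => [/le_anti/val_inj ->|].
    by exists v.
  by case=> w _ [-> ->]; rewrite lexx.
rewrite -cU -cI cardsUI cge addnn -muln2 leq_mul2r/=.
(* It remains that [f] maps the blocks injectively into [le2]. *)
rewrite -(card_in_imset (f := f)).
  apply/subset_leq_card/fintype.subsetP => _ /imsetP[jk + ->].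
  by rewrite !inE => -[jk_le _ _]; exact: x_le.
move=> [j k] [j' k']; rewrite !inE => -[_ /= sj ek] [_ /= sj' ek'].
by move=> [/block_start_inj -> // /block_end_inj ->].
Qed.

End index_pairs.

Lemma card_nobs n (jk : 'I_n * 'I_n) : (jk.1 <= jk.2)%N ->
  #|(fun i : 'I_n => (jk.1 <= i <= jk.2)%N)| = nobs jk.
Proof.
case: jk => j k /= jk; rewrite /nobs /= addn1 -subSn// -sum1_card.
rewrite -(big_mkord (fun i => (j <= i <= k)%N) (fun=> 1%N)).
rewrite -[RHS]muln1 -sum_nat_const_nat.
rewrite [RHS](big_nat_widenl _ 0)// [RHS](big_nat_widen _ _ n)//.
Qed.

Lemma isotonicity_defect_bound {R : realType} (p : R -> R) (s t : R) :
  (forall t, 0 <= p t <= 1) -> s <= t -> p s - p t <= isotonicity_defect p.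
Proof.
move=> p01 st; apply: ub_le_sup; last by exists (s, t).
(* Differences of values of [p] are at most 1, so [sup] is a true upper bound and not a default
   value. *)
exists 1 => _ [[u v] _ <-] /=.
have /andP[_ u1] := p01 u; have /andP[v0 _] := p01 v.
by rewrite lerBlDr (le_trans u1)// lerDl.
Qed.

(** * Coverage of the bands by a union bound over blocks *)

Section coverage.
Context {R : realType} {n : nat} (x : 'I_n -> R) (p : R -> R) (alpha : R).
Hypothesis p01 : forall t, 0 <= p t <= 1.
Hypothesis x_le : forall i j : 'I_n, (i <= j)%N -> x i <= x j.
Implicit Types (jk : 'I_n * 'I_n).

(** Demanding failure at every index lets an extreme value of [p] on the block serve as comparison
    parameter. *)
Definition upper_miss jk (y : 'I_n -> bool) : bool :=
  [forall (i : 'I_n | (jk.1 <= i <= jk.2)%N),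
     cp_upper (level x alpha) (Zsum y jk) (nobs jk) < p (x i)].

Definition lower_miss jk (y : 'I_n -> bool) : bool :=
  [forall (i : 'I_n | (jk.1 <= i <= jk.2)%N),
     p (x i) < cp_lower (level x alpha) (Zsum y jk) (nobs jk)].

(** Each block right of [t] has an index [i] with [p (x i)] at most its bound; since [t <= x i],
    [p t] exceeds [p (x i)] by at most the defect. *)
Lemma le_Uraw (y : 'I_n -> bool) t : (forall jk, Jset x jk -> ~~ upper_miss jk y) ->
  p t <= Uraw x alpha y t + isotonicity_defect p.
Proof.
move=> hit; have /andP[_ pt1] := p01 t.
have g0 : 0 <= isotonicity_defect p.
  by rewrite -(subrr (p t)) isotonicity_defect_bound.
rewrite /Uraw; set S := (X in X == set0).
case: ifPn => [_|/set0P S0]; first by rewrite (le_trans pt1)// lerDl.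
rewrite -lerBlDr; apply: lb_le_inf => // _ [jk [Jjk /= tx] <-].
have [_ _ _] := Jjk; move: (hit _ Jjk) => /forall_inPn[i /andP[ji ik]].
rewrite -leNgt => pu; apply: le_trans pu.
rewrite lerBlDr -lerBlDl isotonicity_defect_bound//.
exact: le_trans tx (x_le ji).
Qed.

Lemma Lraw_le (y : 'I_n -> bool) t : (forall jk, Jset x jk -> ~~ lower_miss jk y) ->
  Lraw x alpha y t - isotonicity_defect p <= p t.
Proof.
move=> hit; have /andP[pt0 _] := p01 t.
have g0 : 0 <= isotonicity_defect p.
  by rewrite -(subrr (p t)) isotonicity_defect_bound.
rewrite /Lraw; set S := (X in X == set0).
case: ifPn => [_|/set0P S0]; first by rewrite (le_trans _ pt0)// sub0r oppr_le0.
rewrite lerBlDr; apply: ge_sup => // _ [jk [Jjk /= xt] <-].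
move: (hit _ Jjk) => /forall_inPn[i /andP[ji ik]].
rewrite -leNgt => lp; apply: (le_trans lp).
rewrite -lerBlDl isotonicity_defect_bound//.
exact: le_trans (x_le ik) xt.
Qed.

Definition covered (y : 'I_n -> bool) : Prop := forall t,
  Lraw x alpha y t - isotonicity_defect p <= p t
    <= Uraw x alpha y t + isotonicity_defect p.

Hypothesis n_gt0 : (0 < n)%N.
Hypothesis alpha_ge0 : 0 <= alpha.

(** Union bound: an uncovered outcome lies in some miss event, each block costs at most twice the
    level, and [card_Jset] bounds the number of blocks. *)
Lemma not_covered_le :
  \sum_(y : {ffun 'I_n -> bool} | ~~ `[< covered y >]) bern_weight (p \o x) y <= alpha.
Proof.
have pxw01 i : 0 <= (p \o x) i <= 1 by exact: p01.
have w0 (y : {ffun 'I_n -> bool}) : 0 <= bern_weight (p \o x) y by exact: bern_weight_ge0.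
set w := bern_weight (p \o x) in w0 *.
(* Positivity of N makes the denominator of [level] nonzero. *)
have N_gt0 : (0 < ndistinct x)%N.
  rewrite /ndistinct lt0n size_eq0; apply/negP => /eqP x0.
  have : x (Ordinal n_gt0) \in undup (codom x) by rewrite mem_undup codom_f.
  by rewrite x0.
set M := (ndistinct x ^ 2 + ndistinct x)%N.
have M_gt0 : (0 < M)%N by rewrite addn_gt0 N_gt0 orbT.
have lvl0 : 0 <= level x alpha by rewrite divr_ge0.
pose J := [pred jk | `[< Jset x jk >]].
pose miss jk (y : {ffun 'I_n -> bool}) : R :=
  (if upper_miss jk y then w y else 0) + (if lower_miss jk y then w y else 0).
have miss0 jk y : 0 <= miss jk y.
  by rewrite addr_ge0//; case: ifP.
apply: (@le_trans _ _ (\sum_y \sum_(jk | J jk) miss jk y)).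
  rewrite big_mkcond; apply: ler_sum => y _.
  case: ifPn => [/asboolP yN|_]; last by apply: sumr_ge0.
  have [jk Jjk bad] : exists2 jk, Jset x jk & upper_miss jk y || lower_miss jk y.
    apply: contrapT => /forall2NP nobad; apply: yN => t.
    by rewrite le_Uraw ?Lraw_le// => jk; case: (nobad jk) => // /negP;
      rewrite negb_or => /andP[].
  rewrite (bigD1 jk)/=; last exact/asboolP.
  apply: (@le_trans _ _ (miss jk y)); last by rewrite lerDl sumr_ge0.
  by case/orP: bad => h; rewrite /miss h ?lerDl ?lerDr//; case: ifP.
rewrite exchange_big/=.
apply: (@le_trans _ _ (\sum_(jk | J jk) (level x alpha *+ 2))).
  apply: ler_sum => jk /asboolP[jk_le _ _].
  have jk0 : exists i : 'I_n, (jk.1 <= i <= jk.2)%N by exists jk.1; rewrite leqnn.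
  rewrite big_split -!big_mkcond mulr2n; apply: lerD.
    have := cp_upper_miscoverage pxw01 lvl0 jk0.
    by rewrite card_nobs.
  have := cp_lower_miscoverage pxw01 lvl0 jk0.
  by rewrite card_nobs.
rewrite sumr_const -mulrnA -mulr_natr /level mulrAC -mulrA ler_piMr//.
rewrite ler_pdivrMr ?ltr0n// mul1r ler_nat mulnC; exact: card_Jset.
Qed.

End coverage.

Unset Implicit Arguments.

Theorem theoremA1 (R : realType) (d : measure_display) (T : measurableType d)
    (P : probability T R) (n : nat) (x : 'I_n -> R) (p : R -> R)
    (Y : 'I_n -> {RV P >-> bool}) (alpha : R)
    (n_gt0 : (0 < n)%N)
    (x_le : forall i j : 'I_n, (i <= j)%N -> x i <= x j)
    (p01 : forall t, 0 <= p t <= 1)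
    (Yind : mutually_independent Y)
    (Yp : forall i, P (Y i @^-1` [set true]) = (p (x i))%:E)
    (alpha01 : 0 < alpha < 1) :
  let gamma := isotonicity_defect p in
  0 <= gamma /\
  ((1 - alpha)%:E <=
    P [set w | forall t : R,
         (Lraw x alpha (fun i => Y i w) t - gamma <= p t
            <= Uraw x alpha (fun i => Y i w) t + gamma)%R])%E.
Proof.
have /andP[a0 a1] := alpha01.
move=> gamma; split.
  by rewrite -(subrr (p 0)) isotonicity_defect_bound.
pose Q (y : {ffun 'I_n -> bool}) := `[< covered x p alpha y >].
rewrite (_ : [set w | _] = [set w | Q [ffun i => Y i w]]); last first.
  have yE w : fun_of_fin [ffun i => Y i w] = (fun i => Y i w).
    by apply: boolp.funext => i; rewrite ffunE.
  by apply/seteqP; split=> w; rewrite /= /Q asboolE /covered yE.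
rewrite (probability_bern_weight (p := p \o x)) // lee_fin.
(* The total weight 1 splits into covered and uncovered outcomes. *)
have := sum_bern_weight (p \o x); rewrite (bigID Q)/= => tot.
have := not_covered_le p01 x_le n_gt0 (ltW a0); rewrite -/Q => bad.
by rewrite lerBlDr -tot lerD2l.
Qed.
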